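(* Let $n,k,m\ge 1$ be integers, let $S_1,\dots,S_k$ and $C_1,\dots,C_m$ be nonempty, closed, convex subsets of $\mathbb{R}^n$, and consider the generalized $(k,m)$-Heron problem $$\min_{Z\in A}\ F(Z)=\sum_{i=1}^k\sum_{j=1}^m\|x_i-y_j\|,\qquad Z=(x_1,\dots,x_k,y_1,\dots,y_m),\qquad A=S_1\times\cdots\times S_k\times C_1\times\cdots\times C_m.$$ Assume that at least one of the sets $S_1,\dots,S_k,C_1,\dots,C_m$ is bounded (which guarantees that an optimal solution $Z^*\in A$ exists), and let $F^*:=F(Z^* )=\min_{Z\in A}F(Z)$. Let $\{Z_t\}_{t\ge 0}$ be a sequence generated by the projected subgradient algorithm: $Z_0\in A$ and $$Z_{t+1}=\operatorname{proj}_A(Z_t-\alpha_t g_t),\qquad t=0,1,2,\dots,$$ where $g_t\in\partial F(Z_t)$ for each $t$ and the step sizes satisfy $$\alpha_t>0,\qquad \sum_{t=0}^\infty\alpha_t=\infty,\qquad \sum_{t=0}^\infty\alpha_t^2<\infty.$$ Then the best-iterate objective values $F_{\mathrm{best}}^{(N)}:=\min_{0\le t<N}F(Z_t)$ satisfy $\lim_{N\to\infty}F_{\mathrm{best}}^{(N)}=F^*$, and the sequence $Z_t$ converges to an optimal solution, i.e. to some $\bar Z\in A$ with $F(\bar Z)=F^*$.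
   Context: $\|\cdot\|$ denotes the Euclidean norm. $\operatorname{proj}_A$ denotes the Euclidean projection onto the nonempty closed convex set $A\subset\mathbb{R}^{n(k+m)}$, i.e. $\operatorname{proj}_A(W)$ is the unique point of $A$ nearest to $W$. For the convex function $F:\mathbb{R}^{n(k+m)}\to\mathbb{R}$, the subdifferential is $\partial F(Z)=\{g\in\mathbb{R}^{n(k+m)}\mid F(W)\ge F(Z)+\langle g,W-Z\rangle\ \ \forall W\in\mathbb{R}^{n(k+m)}\}$. *)

(* Defs.v *)
From HB Require Import structures.
From mathcomp Require Export all_boot all_order all_algebra.
From mathcomp Require Export all_classical all_reals all_analysis.

Set Implicit Arguments.
Unset Strict Implicit.
Unset Printing Implicit Defensive.

Import Order.TTheory GRing.Theory Num.Theory.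
Import numFieldNormedType.Exports.

Local Open Scope classical_set_scope.
Local Open Scope ring_scope.

(* R^(p * q) is represented by p x q matrices, with the Euclidean structure on
   the entries.  The library norm `|_| on matrices is the sup norm; it induces
   the same topology and the same bounded sets as [enorm], so [closed],
   [bounded_set] and limits are taken from the library. *)

Definition inner (R : realType) (p q : nat) (X Y : 'M[R]_(p, q)) : R :=
  \sum_(i < p) \sum_(j < q) X i j * Y i j.

Definition enorm (R : realType) (p q : nat) (X : 'M[R]_(p, q)) : R :=
  Num.sqrt (inner X X).

Definition subdifferential (R : realType) (p q : nat)
    (F : 'M[R]_(p, q) -> R) (Z : 'M[R]_(p, q)) : set 'M[R]_(p, q) :=
  [set g | forall W, F Z + inner g (W - Z) <= F W].

Definition nearest (R : realType) (p q : nat)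
    (A : set 'M[R]_(p, q)) (W : 'M[R]_(p, q)) : set 'M[R]_(p, q) :=
  [set P | A P /\ forall Q, A Q -> enorm (W - P) <= enorm (W - Q)].

(* When A is nonempty, closed and convex, [nearest A W] is a singleton; the
   default value 0 only matters for other sets A. *)
Definition proj (R : realType) (p q : nat)
    (A : set 'M[R]_(p, q)) (W : 'M[R]_(p, q)) : 'M[R]_(p, q) :=
  xget 0 (nearest A W).

Definition minimizer (T : Type) (R : realType) (F : T -> R) (A : set T) :
    set T :=
  [set Z | A Z /\ forall W, A W -> F Z <= F W].

(* A point Z = (x_1, ..., x_k, y_1, ..., y_m) is a (k + m) x n matrix: the
   first k rows are the x_i, the last m rows are the y_j. *)

Definition xpt (R : realType) (n k m : nat) (Z : 'M[R]_(k + m, n)) (i : 'I_k) :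
  'rV[R]_n := row (lshift m i) Z.

Definition ypt (R : realType) (n k m : nat) (Z : 'M[R]_(k + m, n)) (j : 'I_m) :
  'rV[R]_n := row (rshift k j) Z.

Definition heron_obj (R : realType) (n k m : nat) (Z : 'M[R]_(k + m, n)) : R :=
  \sum_(i < k) \sum_(j < m) enorm (xpt Z i - ypt Z j).

Definition heron_set (R : realType) (n k m : nat)
    (S : 'I_k -> set 'rV[R]_n) (C : 'I_m -> set 'rV[R]_n) :
    set 'M[R]_(k + m, n) :=
  [set Z | (forall i, S i (xpt Z i)) /\ (forall j, C j (ypt Z j))].

(* The minimum of f 0, ..., f (N - 1) for N >= 1; the value at N = 0, where the
   minimum is over the empty set, is f 0. *)
Definition best (R : realType) (f : nat -> R) (N : nat) : R :=
  \big[Num.min/f 0%N]_(0 <= t < N) f t.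

(* Main.v *)
(* Obtuseness of the angle at a projection makes proj_A move every point towards
   every W in A, so expanding the square and using the subgradient inequality,
     |Z_{t+1} - W|^2 <= |Z_t - W|^2 - 2 alpha_t (F(Z_t) - F(W)) + L^2 alpha_t^2,
   where L is a Lipschitz constant of F, hence a bound on its subgradients.
   For W optimal, the divergence of sum alpha_t forces F(Z_t) to come
   arbitrarily close to F* infinitely often, and |Z_t - W|^2 is nonincreasing up
   to the summable errors L^2 alpha_t^2 (quasi-Fejer monotonicity).  The Z_t are
   therefore bounded and have an optimal cluster point; quasi-Fejer monotonicity
   with respect to that point upgrades it to the limit.  A minimizer exists
   because one bounded factor makes the sublevel sets of F on A bounded: F
   controls all the distances |x_i - y_j|. *)

Require Import Defs.
From mathcomp Require Import ring lra.
Import Order.TTheory GRing.Theory Num.Theory.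
Import numFieldNormedType.Exports.
Local Open Scope classical_set_scope.
Local Open Scope ring_scope.
Set Implicit Arguments.
Unset Strict Implicit.
Unset Printing Implicit Defensive.

(** * Euclidean inner product and norm, and comparison with the sup norm *)

Section Euclid.
Context {R : realType} {p q : nat}.
Implicit Types (X Y W : 'M[R]_(p, q)) (a : R).

Lemma innerC X Y : inner X Y = inner Y X.
Proof. by apply: eq_bigr => i _; apply: eq_bigr => j _; rewrite mulrC. Qed.

Lemma innerDl X Y W : inner (X + Y) W = inner X W + inner Y W.
Proof.
rewrite /inner -big_split; apply: eq_bigr => i _ /=.
by rewrite -big_split; apply: eq_bigr => j _ /=; rewrite !mxE mulrDl.
Qed.

Lemma innerZl a X Y : inner (a *: X) Y = a * inner X Y.
Proof.
rewrite /inner mulr_sumr; apply: eq_bigr => i _.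
by rewrite mulr_sumr; apply: eq_bigr => j _; rewrite !mxE mulrA.
Qed.

Lemma innerNl X Y : inner (- X) Y = - inner X Y.
Proof. by rewrite -scaleN1r innerZl mulN1r. Qed.

Lemma innerDr X Y W : inner W (X + Y) = inner W X + inner W Y.
Proof. by rewrite innerC innerDl ![inner _ W]innerC. Qed.

Lemma innerZr a X Y : inner X (a *: Y) = a * inner X Y.
Proof. by rewrite innerC innerZl innerC. Qed.

Lemma innerNr X Y : inner X (- Y) = - inner X Y.
Proof. by rewrite innerC innerNl innerC. Qed.

Lemma inner_sqrD X Y :
  inner (X + Y) (X + Y) = inner X X + 2 * inner X Y + inner Y Y.
Proof. rewrite innerDl !innerDr [inner Y X]innerC; ring. Qed.

Lemma inner_sqrB X Y :
  inner (X - Y) (X - Y) = inner X X - 2 * inner X Y + inner Y Y.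
Proof. rewrite inner_sqrD !innerNr innerNl; ring. Qed.

Lemma inner_ge0 X : 0 <= inner X X.
Proof.
by apply: sumr_ge0 => i _; apply: sumr_ge0 => j _; rewrite -expr2 sqr_ge0.
Qed.

Lemma enorm_ge0 X : 0 <= enorm X. Proof. exact: sqrtr_ge0. Qed.

Lemma enorm_sqr X : enorm X ^+ 2 = inner X X.
Proof. by rewrite sqr_sqrtr ?inner_ge0. Qed.

Lemma enormN X : enorm (- X) = enorm X.
Proof. by rewrite /enorm innerNl innerNr opprK. Qed.

Lemma enormB X Y : enorm (X - Y) = enorm (Y - X).
Proof. by rewrite -enormN opprB. Qed.

Lemma ler_enorm_sqr X Y : (enorm X <= enorm Y) = (inner X X <= inner Y Y).
Proof. by rewrite ler_sqrt ?inner_ge0. Qed.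

Lemma entry_le_enorm X i j : `|X i j| <= enorm X.
Proof.
rewrite -sqrtr_sqr ler_sqrt ?inner_ge0// /inner (bigD1 i)//= (bigD1 j)//= -expr2.
rewrite -addrA lerDl addr_ge0// sumr_ge0// => *; first by rewrite -expr2 sqr_ge0.
by apply: sumr_ge0 => *; rewrite -expr2 sqr_ge0.
Qed.

Lemma mx_norm_le_enorm X : `|X| <= enorm X.
Proof.
rewrite [leLHS]/Num.norm/= mx_normrE; apply/bigmax_leP; split => [|ij _].
  exact: enorm_ge0.
exact: entry_le_enorm.
Qed.

Lemma enorm_eq0 X : enorm X = 0 -> X = 0.
Proof.
move=> X0; apply/matrixP => i j; rewrite mxE; apply/normr0_eq0/le_anti.
by rewrite normr_ge0 -X0 entry_le_enorm.
Qed.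

(** Cauchy-Schwarz, from the nonnegative square of [enorm Y *: X - enorm X *: Y]. It equals
    [2 * P * (P - inner X Y)] with [P = enorm X * enorm Y], and [P] can be cancelled once both norms
    are nonzero. *)
Lemma inner_le_enorm X Y : inner X Y <= enorm X * enorm Y.
Proof.
have [/enorm_eq0 ->|Y0] := eqVneq (enorm Y) 0.
  by rewrite -(scale0r 0) innerZr mul0r mulr_ge0 ?enorm_ge0.
have [/enorm_eq0 ->|X0] := eqVneq (enorm X) 0.
  by rewrite -(scale0r 0) innerZl mul0r mulr_ge0 ?enorm_ge0.
have XY : 0 < enorm X * enorm Y.
  by rewrite mulr_gt0// lt_neqAle eq_sym ?X0 ?Y0 enorm_ge0.
have := inner_ge0 (enorm Y *: X - enorm X *: Y).
rewrite inner_sqrB !innerZl !innerZr -!enorm_sqr.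
by move=> H; rewrite -subr_ge0 -(pmulr_rge0 _ XY); nra.
Qed.

Lemma ler_enormD X Y : enorm (X + Y) <= enorm X + enorm Y.
Proof.
rewrite -(@ler_pXn2r _ 2)// ?nnegrE ?addr_ge0 ?enorm_ge0//.
rewrite sqrrD !enorm_sqr inner_sqrD.
have := inner_le_enorm X Y; lra.
Qed.

Lemma ler_enormB X Y : enorm X - enorm Y <= enorm (X - Y).
Proof. by rewrite lerBlDr; have := ler_enormD (X - Y) Y; rewrite subrK. Qed.

Lemma enorm_le_mx_norm X : enorm X <= Num.sqrt (p * q)%:R * `|X|.
Proof.
have e ij : `|X ij.1 ij.2| <= `|X|.
  by rewrite [leRHS]/Num.norm/= mx_normrE; apply: le_bigmax.
rewrite -[`|X|]ger0_norm// -sqrtr_sqr -sqrtrM// ler_sqrt ?mulr_ge0 ?sqr_ge0//.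
have -> : (p * q)%N = #|{: 'I_p * 'I_q}| by rewrite card_prod !card_ord.
rewrite /inner pair_big/= mulr_natl -sumr_const; apply: ler_sum => ij _.
by rewrite -expr2 -real_normK ?num_real// lerXn2r ?nnegrE.
Qed.

End Euclid.

(** * Continuity, compactness, projections onto convex sets and subgradients *)

Section EuclidTopology.
Context {R : realType} {p q : nat}.
Implicit Types (X Y W P Q : 'M[R]_(p, q)) (A : set 'M[R]_(p, q)).

Lemma enorm_lipschitz_continuous (f : 'M[R]_(p, q) -> R) (L : R) :
  (forall X Y, f X - f Y <= L * enorm (X - Y)) -> continuous f.
Proof.
move=> fL X; apply/(@cvgrPdist_lt _ _ _ (nbhs X) (nbhs_filter X)) => e e0.
(* A Lipschitz constant of [f] for the sup norm; the added [1] makes it positive, so that [e / c] is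
   a valid radius. *)
pose c := `|L| * Num.sqrt (p * q)%:R + 1.
have c0 : 0 < c by rewrite ltr_wpDl// mulr_ge0// sqrtr_ge0.
near=> Y.
have XY : `|X - Y| < e / c.
  near: Y; apply/nbhs_ballP; exists (e / c); first exact: divr_gt0.
  by rewrite -ball_normE.
have H : `|f X - f Y| <= `|L| * enorm (X - Y).
  rewrite ler_norml lerNl opprB {1}enormB; apply/andP.
  by split; apply: le_trans (fL _ _) _; rewrite ler_wpM2r ?enorm_ge0 ?ler_norm.
apply: (le_lt_trans H).
apply: (@le_lt_trans _ _ (c * `|X - Y|)); last by rewrite mulrC -ltr_pdivlMr.
rewrite mulrDl mul1r; have := enorm_le_mx_norm (X - Y).
move=> /(ler_wpM2l (normr_ge0 L)); rewrite mulrA => h.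
by apply: (le_trans h); rewrite lerDl.
Unshelve. all: by end_near. Qed.

Lemma enorm_continuous W : continuous (fun X => enorm (X - W)).
Proof.
apply: (@enorm_lipschitz_continuous _ 1) => X Y; rewrite mul1r.
by apply: le_trans (ler_enormB _ _) _; rewrite opprB addrA subrK.
Qed.

Lemma vec_mx_continuous : continuous (@vec_mx R p q).
Proof.
move=> v B /= /nbhs_ballP[e e0 eB]; apply/nbhs_ballP; exists e => //= w vw.
by apply: eB; split=> // i j; rewrite !mxE; case: vw.
Qed.

(** Heine-Borel for row vectors, transported along [vec_mx]: [A] is the continuous image of its
    closed, bounded preimage. *)
Lemma enorm_bounded_closed_compact A (r : R) :
  (forall X, A X -> enorm X <= r) -> closed A -> compact A.
Proof.
move=> Ar Acl; have -> : A = vec_mx @` (vec_mx @^-1` A).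
  rewrite eqEsubset; split=> [X AX|_ [v Av <-]//].
  by exists (mxvec X); rewrite /= mxvecK.
apply: continuous_compact.
  by apply: continuous_subspaceT; exact: vec_mx_continuous.
apply: bounded_closed_compact; last first.
  by apply: preimage_closed Acl => v _; exact: vec_mx_continuous.
exists r; split; first exact: num_real.
move=> s rs v /= /Ar vr; apply: le_trans (ltW rs); apply: le_trans vr.
rewrite [leLHS]/Num.norm/= mx_normrE; apply/bigmax_leP; split => [|[i j] _].
  exact: enorm_ge0.
rewrite /= (ord1 i); case/mxvec_indexP: j => k l.
by rewrite -[v]vec_mxK mxvecE vec_mxK entry_le_enorm.
Qed.

Lemma nearest_exists A W : A !=set0 -> closed A -> exists P, nearest A W P.
Proof.
move=> [Q0 AQ0] Acl.
(* Only points at least as close to [W] as [Q0] compete, which replaces [A] by a compact set. *)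
pose B := A `&` [set P | enorm (P - W) <= enorm (Q0 - W)].
have Bcl : closed B.
  apply: closedI => //.
  apply: (@preimage_closed _ _ _ [set x | x <= _]); last exact: closed_le.
  by move=> X _; exact: enorm_continuous.
have Bcpt : compact B.
  apply: (@enorm_bounded_closed_compact _ (enorm (Q0 - W) + enorm W)) => //.
  move=> X [_ /= XW]; rewrite -[X](subrK W); apply: le_trans (ler_enormD _ _) _.
  by rewrite lerD2r.
have B0 : B !=set0 by exists Q0; split=> /=.
have [] := compact_EVT_min B0 Bcpt (continuous_subspaceT (@enorm_continuous W)).
move=> P /set_mem[AP PW] Pmin; exists P; split=> // Q AQ.
rewrite ![enorm (W - _)]enormB.
have [QW|/ltW QW] := leP (enorm (Q - W)) (enorm (Q0 - W)).
  by apply: Pmin; rewrite inE; split.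
exact: le_trans PW QW.
Qed.

Lemma projP A W : A !=set0 -> closed A -> nearest A W (proj A W).
Proof. by move=> A0 Acl; exact: xgetPex (nearest_exists W A0 Acl). Qed.

Lemma convex_set_segment A P Q (l : R) :
  convex_set A -> A P -> A Q -> 0 <= l -> l <= 1 -> A (P + l *: (Q - P)).
Proof.
move=> Acvx AP AQ l0 l1.
have := Acvx Q P (Itv01 l0 l1) (mem_set AQ) (mem_set AP); rewrite inE.
congr (A _); rewrite /conv/= scalerBl scalerBr scale1r.
by rewrite addrA addrAC [LHS]addrC addrA.
Qed.

(* Perturbing P towards Q by a step l gives -2l<W-P,Q-P> + l^2|Q-P|^2 >= 0;
   a small enough l then excludes <W-P,Q-P> > 0. *)
Lemma nearest_inner_le0 A W P Q :
  convex_set A -> nearest A W P -> A Q -> inner (W - P) (Q - P) <= 0.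
Proof.
move=> Acvx [AP Pmin] AQ; rewrite leNgt; apply/negP.
set u := inner _ _ => u0; pose v := inner (Q - P) (Q - P).
have v0 : 0 <= v by exact: inner_ge0.
(* With this choice [l <= 1], so the perturbed point stays on the segment, and [l * v < u], so
   [l * v - 2 * u] is negative. *)
pose l := u / (u + v + 1).
have uv0 : 0 < u + v + 1 by rewrite ltr_wpDl// addr_ge0// ltW.
have l0 : 0 < l by rewrite divr_gt0.
have lE : l * (u + v + 1) = u by rewrite divfK// gt_eqF.
have l1 : l <= 1 by rewrite ler_pdivrMr// mul1r -addrA lerDl addr_ge0.
have := Pmin _ (convex_set_segment Acvx AP AQ (ltW l0) l1).
rewrite ler_enorm_sqr opprD addrA [X in _ <= X]inner_sqrB.
rewrite !innerZl !innerZr -/u -/v => H.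
have : 0 <= l * (l * v - 2 * u) by lra.
by rewrite pmulr_rge0//; nra.
Qed.

(** In the square of [(W - P) + (P - Q)] the cross term is nonnegative, by obtuseness of the angle
    at [P]. *)
Lemma nearest_dist A W P Q : convex_set A -> nearest A W P -> A Q ->
  inner (P - Q) (P - Q) <= inner (W - Q) (W - Q).
Proof.
move=> Acvx WP AQ; have := nearest_inner_le0 Acvx WP AQ.
have -> : W - Q = (W - P) + (P - Q) by rewrite addrA subrK.
have -> : Q - P = - (P - Q) by rewrite opprB.
rewrite innerNr => obtuse; rewrite [leRHS]inner_sqrD.
have := inner_ge0 (W - P); lra.
Qed.

(** Moving from [Z] in the direction [g] itself, the subgradient inequality gives a growth of at
    least [inner g g], the Lipschitz bound at most [L * enorm g]. *)
Lemma subgradient_bound (F : 'M[R]_(p, q) -> R) (L : R) Z g :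
  (forall X Y, F X - F Y <= L * enorm (X - Y)) -> subdifferential F Z g ->
  inner g g <= L ^+ 2.
Proof.
move=> FL /(_ (Z + g)); rewrite [Z + g - Z]addrAC subrr add0r => gle.
have := FL (Z + g) Z; rewrite [Z + g - Z]addrAC subrr add0r => gL.
rewrite -enorm_sqr in gle *.
have := enorm_ge0 g; set e := enorm g in gle gL *; move=> e0.
have [->|en0] := eqVneq e 0; first by rewrite expr0n/= sqr_ge0.
have : e * e <= L * e by rewrite -expr2; lra.
have ep : 0 < e by rewrite lt_neqAle eq_sym en0.
by rewrite ler_pM2r// => eL; rewrite lerXn2r// nnegrE (le_trans e0).
Qed.

End EuclidTopology.

(** * Real recursions with summable errors, and running minima *)

Section ScalarSequences.
Context {R : realType}.
Implicit Types (d a v : nat -> R) (c e : R).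

(** Telescoping. Starting at an arbitrary [s] leaves only the errors after [s], which become small
    when the series converges. *)
Lemma quasi_fejer_le d a c (s t : nat) :
  (forall k, d k.+1 <= d k + c * a k) -> (s <= t)%N ->
  d t <= d s + c * (series a t - series a s).
Proof.
move=> dS; elim: t => [|t IH].
  by rewrite leqn0 => /eqP->; rewrite subrr mulr0 addr0.
rewrite leq_eqVlt => /predU1P[->|]; first by rewrite subrr mulr0 addr0.
rewrite ltnS => /IH dt; apply: le_trans (dS t) _.
by rewrite seriesSr; lra.
Qed.

Lemma series_ge0_le_lim a (t : nat) :
  (forall k, 0 <= a k) -> cvgn (series a) -> series a t <= limn (series a).
Proof.
move=> a0 acv; apply: nondecreasing_cvgn_le acv t.
by apply/nondecreasing_seqP => k; rewrite seriesSr lerDl.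
Qed.

(** If [v] stayed above [e] from [N] on, summing the recursion would bound [2 * e] times the partial
    sums of [a] by a constant, against their divergence. *)
Lemma divergent_steps_small_gap d a v c e (N : nat) :
  0 <= c -> (forall t, 0 <= d t) -> (forall t, 0 < a t) ->
  series a @ \oo --> +oo -> cvgn (series (fun t => a t ^+ 2)) ->
  (forall t, d t.+1 <= d t - 2 * a t * v t + c * a t ^+ 2) -> 0 < e ->
  exists2 t, (N <= t)%N & v t < e.
Proof.
move=> c0 d0 a0 /cvgryPge aoo a2 dS e0; apply: contrapT => nex.
have vge t : (N <= t)%N -> e <= v t.
  by move=> Nt; rewrite leNgt; apply/negP => vt; apply: nex; exists t.
set Q := series _ in a2.
have Qlim t : Q t <= limn Q by apply: series_ge0_le_lim a2 => k; exact: sqr_ge0.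
have H t : (N <= t)%N ->
    d t + 2 * e * (series a t - series a N) <= d N + c * (Q t - Q N).
  elim: t => [|t IH]; first by rewrite leqn0 => /eqP->; rewrite !subrr !mulr0.
  rewrite leq_eqVlt => /predU1P[->|]; first by rewrite !subrr !mulr0.
  rewrite ltnS => Nt; have := IH Nt; have := dS t.
  have : a t * e <= a t * v t by rewrite ler_pM2l// vge.
  rewrite /Q !seriesSr; lra.
(* The level at which the partial sum of [a] exceeds the bound given by [H]; the [1] makes the
   excess strict. *)
pose M := series a N + (d N + c * (limn Q - Q N)) / (2 * e) + 1.
have [t /andP[Nt Mt]] : exists t, (N <= t)%N && (M <= series a t).
  have /filter_ex[t [Nt Mt]] :
    \forall t \near \oo, (N <= t)%N /\ M <= series a t.
    by apply: filterI (aoo M); exact: nbhs_infty_ge.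
  by exists t; rewrite Nt.
have e20 : 0 < 2 * e by rewrite mulr_gt0.
have : 2 * e * (series a t - series a N) <= d N + c * (limn Q - Q N).
  have := H t Nt; have := d0 t; have := ler_wpM2l c0 (Qlim t); lra.
rewrite mulrC -ler_pdivlMr//; move: Mt; rewrite /M; lra.
Qed.

Lemma best_le (f : nat -> R) (t N : nat) : (t < N)%N -> best f N <= f t.
Proof. by move=> tN; apply: ge_bigmin_seq => //; rewrite mem_index_iota. Qed.

(** The default value [f 0] of the minimum obeys the same bound, so [N = 0] is included. *)
Lemma le_best (f : nat -> R) x N : (forall t, x <= f t) -> x <= best f N.
Proof. by move=> xf; apply: le_bigmin. Qed.

End ScalarSequences.

(** * The projected subgradient method for a Lipschitz objective on a closed convex set *)

Section ProjectedSubgradient.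
Context {R : realType} {p q : nat}.
Implicit Types (A : set 'M[R]_(p, q)) (F : 'M[R]_(p, q) -> R).

Lemma compact_seq_cluster A (u : nat -> 'M[R]_(p, q)) :
  compact A -> (forall n, A (u n)) -> exists2 X, A X &
  forall (e : R) (N : nat), 0 < e -> exists2 n, (N <= n)%N & enorm (u n - X) < e.
Proof.
move=> Acpt Au; have uA : (u @ \oo) A by exists 0%N => // n _; exact: Au.
have [X [AX clX]] := Acpt (u @ \oo) _ uA.
exists X => // e N e0.
(* A cluster point makes every tail of [u] meet each of its neighbourhoods, and Euclidean balls are
   neighbourhoods by continuity of [enorm]. *)
have [|| _ [[n Nn <-] unX]] :=
  clX [set u n | n in [set n | (N <= n)%N]] [set Y | enorm (Y - X) < e].
- by exists N => // n Nn; exists n.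
- apply: (cvgr_lt _ (@enorm_continuous _ _ _ X X)).
  by rewrite subrr /enorm -(scale0r 0) innerZl mul0r sqrtr0.
by exists n.
Qed.

(** The point [W] is arbitrary in [A], since the estimate serves first for [Zstar] and later for the
    cluster point. *)
Lemma projected_subgradient_step A F L (Z W g : 'M[R]_(p, q)) a :
  A !=set0 -> closed A -> convex_set A ->
  (forall X Y, F X - F Y <= L * enorm (X - Y)) ->
  subdifferential F Z g -> 0 <= a -> A W ->
  inner (proj A (Z - a *: g) - W) (proj A (Z - a *: g) - W) <=
    inner (Z - W) (Z - W) - 2 * a * (F Z - F W) + L ^+ 2 * a ^+ 2.
Proof.
move=> A0 Acl Acvx FL gZ a0 AW.
apply: le_trans (nearest_dist Acvx (projP (Z - a *: g) A0 Acl) AW) _.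
rewrite (addrAC Z) (inner_sqrB _ (a *: g)) !innerZl !innerZr.
have := gZ W; rewrite -(opprB Z W) innerNr => gW.
have gg := subgradient_bound FL gZ; rewrite [inner (Z - W) g]innerC.
have := ler_wpM2l (sqr_ge0 a) gg.
have : a * (F Z - F W) <= a * inner g (Z - W) by apply: ler_wpM2l => //; lra.
rewrite expr2; lra.
Qed.

Theorem projected_subgradient_cvg A F L (Zstar : 'M[R]_(p, q))
    (Z g : nat -> 'M[R]_(p, q)) (alpha : nat -> R) :
  closed A -> convex_set A ->
  (forall X Y, F X - F Y <= L * enorm (X - Y)) ->
  minimizer F A Zstar -> A (Z 0%N) ->
  (forall t, subdifferential F (Z t) (g t)) ->
  (forall t, Z t.+1 = proj A (Z t - alpha t *: g t)) ->
  (forall t, 0 < alpha t) ->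
  series alpha @ \oo --> +oo ->
  cvgn (series (fun t => alpha t ^+ 2)) ->
  best (fun t => F (Z t)) @ \oo --> F Zstar /\
  exists Zbar, [/\ A Zbar, F Zbar = F Zstar & Z @ \oo --> Zbar].
Proof.
move=> Acl Acvx FL [AZs Zsmin] AZ0 gF ZS alpha0 alphaoo alpha2.
have A0 : A !=set0 by exists Zstar.
have AZ t : A (Z t).
  case: t => [//|t]; rewrite ZS.
  by have [] := projP (Z t - alpha t *: g t) A0 Acl.
pose d W t := inner (Z t - W) (Z t - W).
pose c := L ^+ 2.
have c0 : 0 <= c by exact: sqr_ge0.
have step W t : A W ->
    d W t.+1 <= d W t - 2 * alpha t * (F (Z t) - F W) + c * alpha t ^+ 2.
  move=> AW; rewrite /d ZS.
  by apply: projected_subgradient_step => //; exact: ltW.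
have small (e : R) (N : nat) : 0 < e ->
    exists2 t, (N <= t)%N & F (Z t) - F Zstar < e.
  apply: (divergent_steps_small_gap (d := d Zstar) N c0 _ alpha0) => //.
    by move=> t; exact: inner_ge0.
  by move=> t; exact: step.
have fejer W (s t : nat) : A W -> F W = F Zstar -> (s <= t)%N ->
    d W t <= d W s + c * (limn (series (fun k => alpha k ^+ 2)) -
                           series (fun k => alpha k ^+ 2) s).
  move=> AW FW st.
  have dS k : d W k.+1 <= d W k + c * alpha k ^+ 2.
    apply: le_trans (step W k AW) _; rewrite lerD2r gerBl FW.
    by rewrite mulr_ge0 ?subr_ge0 ?Zsmin// mulr_ge0// ltW.
  apply: le_trans (quasi_fejer_le dS st) _; rewrite lerD2l ler_wpM2l// lerD2r.
  by apply: series_ge0_le_lim => // k; exact: sqr_ge0.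
split.
  (* One iterate with gap below [e] suffices: for every [N > t] the best value lies between
     [F Zstar] and [F (Z t)]. *)
  apply/cvgrPdist_lt => e e0; have [t _ te] := small e 0%N e0.
  near=> N; have tN : (t < N)%N by near: N; exact: nbhs_infty_gt.
  have := best_le (fun t => F (Z t)) tN.
  have := @le_best _ (fun t => F (Z t)) (F Zstar) N (fun t => Zsmin _ (AZ t)).
  by rewrite ltr_norml; lra.
set Q := series _ in alpha2 fejer.
(* The quasi-Fejer bound from time 0 towards [Zstar]: all iterates lie in this ball. *)
pose r := Num.sqrt (d Zstar 0%N + c * (limn Q - Q 0%N)).
pose K := A `&` [set X | enorm (X - Zstar) <= r].
have Kcpt : compact K.
  apply: (@enorm_bounded_closed_compact _ _ _ _ (r + enorm Zstar)).
    move=> X [_ /= XZ]; rewrite -[X](subrK Zstar).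
    by apply: le_trans (ler_enormD _ _) _; rewrite lerD2r.
  apply: closedI => //.
  apply: (@preimage_closed _ _ _ [set x | x <= _]); last exact: closed_le.
  by move=> X _; exact: enorm_continuous.
have KZ t : K (Z t).
  split=> //=; rewrite ler_wsqrtr//; exact: fejer.
(* The cluster point is taken along times [tau n] whose gaps tend to 0, which forces it to be
   optimal. Only [n <= tau n] is required, not monotonicity. *)
have /choice[tau tauP] n :
    exists t, (n <= t)%N /\ F (Z t) - F Zstar < n.+1%:R^-1.
  have [|t nt Ft] := small n.+1%:R^-1 n; first by rewrite invr_gt0 ltr0n.
  by exists t.
have [Zbar [AZb _] Zbcl] := compact_seq_cluster Kcpt (fun n => KZ (tau n)).
have FZb : F Zbar = F Zstar.
  apply/le_anti; rewrite Zsmin// andbT; apply/ler_addgt0Pr => e e0.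
  (* The error [e] is split in two: half for the gap at [Z (tau n)], half for the Lipschitz change
     from there to [Zbar]. *)
  have L0 : 0 < `|L| + 1 by rewrite ltr_wpDl.
  have [N _ Ne] := near_infty_natSinv_lt (PosNum (divr_gt0 e0 (ltr0n R 2))).
  have [|n Nn ne] := Zbcl (e / 2 / (`|L| + 1)) N; first by rewrite !divr_gt0.
  have [_ /lt_trans/(_ (Ne n Nn))/= Fn] := tauP n.
  have := FL Zbar (Z (tau n)); rewrite enormB => FLn.
  move: ne; rewrite ltr_pdivlMr// => ne.
  have : L * enorm (Z (tau n) - Zbar) <= enorm (Z (tau n) - Zbar) * (`|L| + 1).
    by rewrite mulrC ler_wpM2l ?enorm_ge0// (le_trans (ler_norm _))// lerDl.
  by lra.
exists Zbar; split=> //; apply/cvgrPdist_lt => e e0.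
have c10 : 0 < c + 1 by rewrite ltr_wpDl.
(* The squared distance at time [tau n] and the remaining errors are each made less than
   [e ^+ 2 / 4], so all later squared distances stay below [e ^+ 2]. Dividing by [c + 1] avoids the
   case [c = 0]. *)
have e40 : 0 < e ^+ 2 / 4 by rewrite divr_gt0// exprn_gt0.
have /cvgrPdist_lt/(_ _ (divr_gt0 e40 c10))[N _ QN] := alpha2.
have [n Nn ne] := Zbcl (e / 2) N (divr_gt0 e0 (ltr0n R 2)).
exists (tau n) => // t /= nt.
have dt := fejer _ _ _ AZb FZb nt.
(* The limit is taken in the sup norm, which [enorm] dominates. *)
rewrite -normrN opprB; apply: le_lt_trans (mx_norm_le_enorm _) _.
rewrite -(@ltr_pXn2r _ 2)// ?nnegrE ?enorm_ge0 ?(ltW e0)// enorm_sqr.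
apply: le_lt_trans dt _.
have [ntau _] := tauP n.
have := QN (tau n) (leq_trans Nn ntau).
rewrite /= ltr_pdivlMr// => /(le_lt_trans _) Qe.
have {}Qe : c * (limn Q - Q (tau n)) < e ^+ 2 / 4.
  apply: Qe; rewrite mulrC; set x := _ - _.
  apply: (@le_trans _ _ (`|x| * c)); first by rewrite ler_wpM2r// ler_norm.
  by rewrite ler_wpM2l// lerDl.
have : d Zbar (tau n) < e ^+ 2 / 4.
  rewrite /d -enorm_sqr (_ : _ / 4 = (e / 2) ^+ 2); last by field.
  by rewrite ltr_pXn2r// ?nnegrE ?enorm_ge0 ?divr_ge0 ?(ltW e0).
have : 0 < e ^+ 2 by rewrite exprn_gt0.
lra.
Unshelve. all: by end_near. Qed.

End ProjectedSubgradient.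

(** * The Heron objective and feasible set: regularity and existence of a minimizer *)

Section Heron.
Context {R : realType} {n k m : nat}.
Implicit Types (Z W : 'M[R]_(k + m, n)).

Lemma row_continuous (p : nat) (i : 'I_p) :
  continuous (fun X : 'M[R]_(p, n) => row i X).
Proof.
move=> X B /= /nbhs_ballP[e e0 eB]; apply/nbhs_ballP; exists e => //= Y XY.
by apply: eB; split=> // a j; rewrite !mxE; case: XY.
Qed.

Lemma enorm_row_le (p : nat) (X : 'M[R]_(p, n)) i : enorm (row i X) <= enorm X.
Proof.
rewrite /enorm ler_sqrt ?inner_ge0// /inner big_ord1.
rewrite [leRHS](bigD1 i)//= -[leLHS]addr0 lerD//.
  by apply: ler_sum => j _; rewrite !mxE.
by apply: sumr_ge0 => a _; apply: sumr_ge0 => j _; rewrite -expr2 sqr_ge0.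
Qed.

Lemma enorm_le_rows (p : nat) (X : 'M[R]_(p, n)) (r : R) :
  (forall i, enorm (row i X) <= r) -> enorm X <= Num.sqrt (p%:R * r ^+ 2).
Proof.
move=> Xr; rewrite ler_wsqrtr// /inner mulr_natl.
rewrite -[in leRHS](card_ord p) -sumr_const.
apply: ler_sum => i _; apply: (@le_trans _ _ (enorm (row i X) ^+ 2)).
  by rewrite enorm_sqr /inner big_ord1; apply: ler_sum => j _; rewrite !mxE.
by rewrite lerXn2r// nnegrE ?enorm_ge0// (le_trans (enorm_ge0 _) (Xr i)).
Qed.

(** Each of the [k * m] distances changes by at most the displacements of its two rows, and each of
    these is at most [enorm (Z - W)]. *)
Lemma heron_obj_lipschitz Z W :
  heron_obj Z - heron_obj W <= (2 * k%:R * m%:R) * enorm (Z - W).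
Proof.
rewrite /heron_obj -sumrB.
have -> : (2 * k%:R * m%:R) * enorm (Z - W) =
    \sum_(i < k) \sum_(j < m) (2 * enorm (Z - W)).
  by rewrite !sumr_const !card_ord -mulrnA -[RHS]mulr_natl natrM; ring.
apply: ler_sum => i _; rewrite -sumrB; apply: ler_sum => j _.
apply: le_trans (ler_enormB _ _) _.
have -> : xpt Z i - ypt Z j - (xpt W i - ypt W j) =
    xpt (Z - W) i - ypt (Z - W) j.
  by apply/rowP => a; rewrite !mxE; ring.
apply: le_trans (ler_enormD _ _) _; rewrite enormN.
have := enorm_row_le (Z - W) (lshift m i).
have := enorm_row_le (Z - W) (rshift k j).
by rewrite /xpt /ypt; lra.
Qed.

Lemma enorm_le_heron_obj Z i j : enorm (xpt Z i - ypt Z j) <= heron_obj Z.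
Proof.
rewrite /heron_obj (bigD1 i)//= (bigD1 j)//= -addrA lerDl addr_ge0//.
  by apply: sumr_ge0 => *; exact: enorm_ge0.
by apply: sumr_ge0 => *; apply: sumr_ge0 => *; exact: enorm_ge0.
Qed.

Context (S : 'I_k -> set 'rV[R]_n) (C : 'I_m -> set 'rV[R]_n).

Lemma heron_set_neq0 : (forall i, S i !=set0) -> (forall j, C j !=set0) ->
  heron_set S C !=set0.
Proof.
move=> /choice[x Sx] /choice[y Cy].
exists (col_mx (\matrix_i x i) (\matrix_j y j)); split=> [i|j].
  by rewrite /xpt rowKu rowK.
by rewrite /ypt rowKd rowK.
Qed.

Lemma heron_set_closed : (forall i, closed (S i)) -> (forall j, closed (C j)) ->
  closed (heron_set S C).
Proof.
move=> Scl Ccl; rewrite (_ : heron_set S C =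
    (\bigcap_i (@xpt R n k m ^~ i @^-1` S i)) `&`
    \bigcap_j (@ypt R n k m ^~ j @^-1` C j)).
  by apply: closedI; apply: closed_bigI => i _; apply: preimage_closed => // Z _;
     exact: row_continuous.
by rewrite eqEsubset; split=> Z [ZS ZC]; split=> i; do ?move=> _;
  by [exact: ZS|exact: ZC].
Qed.

Lemma heron_set_convex : (forall i, convex_set (S i)) ->
  (forall j, convex_set (C j)) -> convex_set (heron_set S C).
Proof.
move=> Scvx Ccvx Z W l /set_mem[ZS ZC] /set_mem[WS WC].
rewrite inE; split=> [i|j].
  have := Scvx i _ _ l (mem_set (ZS i)) (mem_set (WS i)); rewrite inE.
  by congr (S i _); apply/rowP => a; rewrite /conv/= !mxE.
have := Ccvx j _ _ l (mem_set (ZC j)) (mem_set (WC j)); rewrite inE.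
by congr (C j _); apply/rowP => a; rewrite /conv/= !mxE.
Qed.

Lemma bounded_set_enorm (B : set 'rV[R]_n) : bounded_set B ->
  exists2 r, 0 <= r & forall x, B x -> enorm x <= r.
Proof.
move=> /pinfty_ex_gt0[M M0 BM]; exists (Num.sqrt (1 * n)%:R * M) => [|x Bx].
  by rewrite mulr_ge0// ?sqrtr_ge0// ltW.
apply: le_trans (enorm_le_mx_norm _) _.
by rewrite ler_wpM2l ?sqrtr_ge0//; exact: BM.
Qed.

(** All distances between an [xpt] and a [ypt] are at most [v], so one bounded point bounds those of
    the other kind within [v], and those of its own kind within [2 * v] by a detour through the
    other kind. *)
Lemma heron_sublevel_bounded (v : R) : (0 < k)%N -> (0 < m)%N ->
  (exists i, bounded_set (S i)) \/ (exists j, bounded_set (C j)) ->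
  exists r, forall Z, heron_set S C Z -> heron_obj Z <= v -> enorm Z <= r.
Proof.
move=> k0 m0 bnd.
have [r r0 Zr] : exists2 r, 0 <= r &
    forall Z, heron_set S C Z -> heron_obj Z <= v ->
    (exists i, enorm (xpt Z i) <= r) \/ (exists j, enorm (ypt Z j) <= r).
  case: bnd => [[i /bounded_set_enorm[r r0 Br]]|[j /bounded_set_enorm[r r0 Br]]];
    exists r => // Z [ZS ZC] _; [left; exists i|right; exists j]; exact: Br.
exists (Num.sqrt ((k + m)%:R * (r + 2 * v) ^+ 2)) => Z AZ Zv.
(* Intermediate points for the detours; the pair also yields [0 <= v]. *)
have i0 := Ordinal k0; have j0 := Ordinal m0.
have xy i j : enorm (xpt Z i - ypt Z j) <= v.
  exact: le_trans (enorm_le_heron_obj _ _ _) Zv.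
have v0 : 0 <= v by apply: le_trans (enorm_ge0 _) (xy i0 j0).
have xley i j : enorm (xpt Z i) <= v + enorm (ypt Z j).
  by rewrite -lerBlDr; apply: le_trans (ler_enormB _ _) (xy i j).
have ylex i j : enorm (ypt Z j) <= v + enorm (xpt Z i).
  by rewrite -lerBlDr; apply: le_trans (ler_enormB _ _) _; rewrite enormB.
apply: enorm_le_rows => a.
case: (split_ordP a) => [i ->|j ->]; rewrite -/(xpt Z _) -/(ypt Z _);
  case: (Zr Z AZ Zv) => -[b bh].
- by have := xley i j0; have := ylex b j0; lra.
- by have := xley i b; lra.
- by have := ylex b j; lra.
- by have := ylex i0 j; have := xley i0 b; lra.
Qed.

Lemma heron_minimizer_exists : (0 < k)%N -> (0 < m)%N ->
  heron_set S C !=set0 -> closed (heron_set S C) ->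
  (exists i, bounded_set (S i)) \/ (exists j, bounded_set (C j)) ->
  exists Z, minimizer (@heron_obj R n k m) (heron_set S C) Z.
Proof.
move=> k0 m0 [Z0 AZ0] Acl bnd.
have Fcont : continuous (@heron_obj R n k m).
  exact: enorm_lipschitz_continuous heron_obj_lipschitz.
(* A minimizer over the compact sublevel set of [Z0] is global, since feasible points outside it
   have values above that of [Z0]. *)
pose B := heron_set S C `&` [set Z | heron_obj Z <= heron_obj Z0].
have [r Br] := heron_sublevel_bounded (heron_obj Z0) k0 m0 bnd.
have Bcpt : compact B.
  apply: (@enorm_bounded_closed_compact _ _ _ _ r) => [Z []|]; first exact: Br.
  apply: closedI => //.
  apply: (@preimage_closed _ _ _ [set x | x <= _]); last exact: closed_le.
  by move=> Z _; exact: Fcont.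
have B0 : B !=set0 by exists Z0; split=> /=.
have [Z /set_mem[AZ ZZ0] Zmin] :=
  compact_EVT_min B0 Bcpt (continuous_subspaceT Fcont).
exists Z; split=> // W AW.
have [WZ0|/ltW Z0W] := leP (heron_obj W) (heron_obj Z0).
  by apply: Zmin; rewrite inE; split.
exact: le_trans ZZ0 Z0W.
Qed.

End Heron.

(** Existence of a minimizer is a separate conclusion; convergence is then stated for any minimizer
    [Zstar], as all of them share the value $F^*$. *)
Theorem theorem4p2 (R : realType) (n k m : nat)
    (hn : (1 <= n)%N) (hk : (1 <= k)%N) (hm : (1 <= m)%N)
    (S : 'I_k -> set 'rV[R]_n) (C : 'I_m -> set 'rV[R]_n)
    (hS : forall i, [/\ S i !=set0, closed (S i) & convex_set (S i)])
    (hC : forall j, [/\ C j !=set0, closed (C j) & convex_set (C j)])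
    (hbounded : (exists i, bounded_set (S i)) \/ (exists j, bounded_set (C j))) :
  let F := @heron_obj R n k m in
  let A := heron_set S C in
  (exists Zstar, minimizer F A Zstar) /\
  forall Zstar, minimizer F A Zstar ->
  forall (Z g : nat -> 'M[R]_(k + m, n)) (alpha : nat -> R),
    A (Z 0%N) ->
    (forall t, subdifferential F (Z t) (g t)) ->
    (forall t, Z t.+1 = proj A (Z t - alpha t *: g t)) ->
    (forall t, 0 < alpha t) ->
    series alpha @ \oo --> +oo ->
    cvgn (series (fun t => alpha t ^+ 2)) ->
    best (fun t => F (Z t)) @ \oo --> F Zstar /\
    exists Zbar, [/\ A Zbar, F Zbar = F Zstar & Z @ \oo --> Zbar].
Proof.
move=> F A.
have Acl : closed A.
  by apply: heron_set_closed => [i|j]; [have [] := hS i|have [] := hC j].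
split.
  apply: heron_minimizer_exists => //.
  by apply: heron_set_neq0 => [i|j]; [have [] := hS i|have [] := hC j].
move=> Zstar Zsmin Z g alpha AZ0 gF ZS.
apply: projected_subgradient_cvg AZ0 gF ZS => //; last exact: heron_obj_lipschitz.
by apply: heron_set_convex => [i|j]; [have [] := hS i|have [] := hC j].
Qed.
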